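(* Let $(E,\|\cdot\|)$ be a normed vector space and let $X$ be a Polish space. Let $C$ be a convex subset of $E$ which is complete for the metric $d_{\|\cdot\|}$, and suppose additionally that $C$ is separable. Let $F:X\to\mathcal F^*_{\mathrm{conv}}(C)$ be a lower continuous map. Then there is a sequence $(f_n)_{n\in\mathbb N}$ of continuous maps $f_n:X\to C$ such that for all $x\in X$, $$F(x)=\overline{\{f_n(x): n\in\mathbb N\}}.$$
   Context: The metric $d_{\|\cdot\|}$ on $E$ is $d_{\|\cdot\|}(v,w)=\|v-w\|$; it is not required to be complete on $E$, only on $C$. $C$ carries the norm topology. $\mathcal F^*_{\mathrm{conv}}(C)$ denotes the set of non-empty convex closed subsets of $C$. A map $F:X\to\mathcal F^*_{\mathrm{conv}}(C)$ is lower continuous if it is continuous for the lower topology, i.e. the topology generated by the sets $\{A: A\cap U\neq\emptyset\}$ with $U\subseteq C$ open; equivalently, $\{x\in X: F(x)\cap U\neq\emptyset\}$ is open in $X$ for every open $U\subseteq C$. A Polish space is a separable topological space whose topology admits a compatible complete metric. *)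

(* Defs.v *)
From HB Require Import structures.
From mathcomp Require Import all_boot all_order all_algebra finmap.
From mathcomp Require Import all_classical all_reals all_analysis.

Set Implicit Arguments.
Unset Strict Implicit.
Unset Printing Implicit Defensive.

Import Order.TTheory GRing.Theory Num.Theory.
Import numFieldNormedType.Exports.

Local Open Scope classical_set_scope.
Local Open Scope ring_scope.

(* The library's `metricType` and `completeType` bundle the metric (resp. a
   base point) with the type; here the metric has to be existentially
   quantified over a given topological space, so it is a plain function. *)
Definition is_metric (R : realType) (T : Type) (d : T -> T -> R) : Prop :=
  [/\ forall x y, 0 <= d x y,
      forall x y, d x y = 0 <-> x = y,
      forall x y, d x y = d y x
    & forall x y z, d x z <= d x y + d y z].

Definition metric_complete (R : realType) (T : Type) (d : T -> T -> R) : Prop :=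
  forall u : nat -> T,
    (forall e : R, 0 < e -> \forall m & n \near \oo, d (u m) (u n) < e) ->
    exists l : T, d (u n) l @[n --> \oo] --> (0 : R).

Definition metric_compatible (R : realType) (T : topologicalType)
    (d : T -> T -> R) : Prop :=
  forall U : set T, open U <->
    forall x, U x -> exists2 e : R, 0 < e & [set y | d x y < e] `<=` U.

Definition separable (T : topologicalType) : Prop :=
  exists2 D : set T, countable D & dense D.

Definition polish (R : realType) (T : topologicalType) : Prop :=
  separable T /\
  exists d : T -> T -> R,
    [/\ is_metric d, metric_compatible d & metric_complete d].

Definition norm_dist (R : realType) (E : normedModType R) (C : set E)
  (v w : C) : R := `|set_val v - set_val w|.

(* For `C : set E`, the coercion `set_type` turns `C` into a type carrying the
   topology induced by `E`; `open`, `closed` and `closure` for `set C` are thus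
   relative to `C`. *)
Record conv_closed (R : realType) (E : normedModType R) (C : set E) : Type :=
  ConvClosed {
    conv_closed_set :> set C ;
    conv_closed_neq0 : conv_closed_set !=set0 ;
    conv_closed_closed : closed conv_closed_set ;
    conv_closed_convex : convex_set (set_val @` conv_closed_set) }.

Section lower_topology.
Context {R : realType} {E : normedModType R} (C : set E).

HB.instance Definition _ := gen_eqMixin (conv_closed C).
HB.instance Definition _ := gen_choiceMixin (conv_closed C).

(* The lower topology, given by its subbase indexed by the open subsets of
   `C`. *)
HB.instance Definition _ := isSubBaseTopological.Build (conv_closed C)
  (@open C) (fun U : set C => [set A : conv_closed C | A `&` U !=set0]).

End lower_topology.

Lemma lower_continuousP (R : realType) (E : normedModType R) (C : set E)
    (X : topologicalType) (F : X -> conv_closed C) :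
  continuous F <->
  forall U : set C, open U -> open [set x | F x `&` U !=set0].
Proof.
rewrite continuousP; split=> H.
  move=> U oU; apply: (H [set A | A `&` U !=set0]).
  exists [set [set A : conv_closed C | A `&` U !=set0]]; last first.
    by rewrite bigcup_set1.
  move=> _ ->; exists (finmap.fset1 U).
    by move=> V /finmap.fset1P ->; exact/mem_set.
  rewrite predeqE => A; split=> [|AU V].
    by apply; rewrite /= finmap.inE eqxx.
  by move=> /finmap.fset1P ->.
move=> _ [B sB <-]; rewrite preimage_bigcup; apply: bigcup_open => _ /sB [D sD <-].
have -> : F @^-1` (\bigcap_(i in [set` D]) [set A : conv_closed C | A `&` i !=set0]) = \bigcap_(i in [set` D]) [set x | F x `&` i !=set0] by [].
move: sD; move: D => D sD.
rewrite bigcap_fset big_seq; elim/big_ind: _ => [|A1 A2|U /sD /set_mem oU];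
  [exact: openT|exact: openI|exact: H].
Qed.

(* Main.v *)
Require Import Defs.
From mathcomp Require Import all_boot all_order all_algebra.
From mathcomp Require Import all_classical all_reals all_analysis.
From mathcomp Require Import ring lra.

Set Implicit Arguments.
Unset Strict Implicit.
Unset Printing Implicit Defensive.

Import Order.TTheory GRing.Theory Num.Theory.
Import numFieldNormedType.Exports.

Local Open Scope classical_set_scope.
Local Open Scope ring_scope.

(** This is the countable form of Michael's selection theorem: apply the
    selection theorem not to [F] itself but to countably many modifications of
    [F] whose selections are steered towards prescribed points.

    Fix a dense sequence [c] of [C].  A lower continuous map [G] with non-empty
    convex values in [C] has, for each [e > 0], a continuous map [g] within [e]
    of it ([exists_approx_selection]): the open sets of points [x] at which
    [G x] comes within [e] of [c n] cover [X], and [g] is a convex combination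
    of the [c n] with locally finite continuous weights supported in these
    sets.  The set of points within [e] of [G x] is convex, so [g x] stays in
    it.  As the cover is countable and each open set of [X] is the positivity
    set of a continuous function ([cozero_open_metric]), the weights are given
    by explicit formulas ([locally_finite_weights]).

    Next, [G x] intersected with the ball of radius [r] around [g x] is again a
    lower continuous convex-valued map, so an approximation can be improved
    while moving it only slightly.  Iterating with errors [2 ^- k] gives a
    uniformly Cauchy sequence; its limit exists since [C] is complete, and it
    selects from the closure of [G] ([michael_selection]).  Aiming at the
    closure allows values that are not closed, such as the intersection of
    [F x] with an open ball.

    Finally, let [U] be the open set of points [x] at which [F x] meets the
    ball of centre [c n] and radius [1 / (m + 1)].  Write [U] as a countable
    union of closed sets [A k], and let [G] be [F] cut down to that ball over
    [A k] and [F] elsewhere.  Closedness of [A k] makes [G] lower continuous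
    ([convex_lower_guided]), and a selection of [G] passes near [c n] over
    [A k].  The selections obtained for all [(n, m, k)] are dense in each
    [F x] ([dense_selections]). *)

(** * Positivity sets of continuous functions *)

Definition cozero (R : realType) (X : topologicalType) (U : set X) : Prop :=
  exists phi : X -> R,
    [/\ continuous phi, forall x, 0 <= phi x <= 1 &
        forall x, U x <-> 0 < phi x].

Lemma near_metric_ball (R : realType) (X : topologicalType) (d : X -> X -> R)
    (x : X) (e : R) :
  is_metric d -> metric_compatible d -> 0 < e -> \forall y \near x, d x y < e.
Proof.
move=> [_ d0 _ dtri] dX e0; apply: open_nbhs_nbhs; split; last first.
  by rewrite /= (d0 x x).2.
apply/dX => y /= xy; exists (e - d x y); first by rewrite subr_gt0.
by move=> z /= yz; apply: le_lt_trans (dtri _ y _) _; lra.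
Qed.

(** The function is the distance to the complement of [U], truncated at 1; the
    truncation also makes the infimum range over a non-empty set when [U] is
    the whole space. *)
Lemma cozero_open_metric (R : realType) (X : topologicalType)
    (d : X -> X -> R) (U : set X) :
  is_metric d -> metric_compatible d -> open U -> cozero R U.
Proof.
move=> dm dX oU; have [dge0 d0 dC dtri] := dm.
pose D x := [set r : R | r = 1 \/ exists2 y, ~ U y & r = d x y].
have D1 x : D x 1 by left.
have Dlb x : lbound (D x) 0 by move=> _ [->//|[y _ ->]].
have Dhlb x : has_lbound (D x) by exists 0.
have D0 x : D x !=set0 by exists 1.
have lip x y : inf (D x) <= inf (D y) + d x y.
  rewrite -lerBlDr; apply: lb_le_inf => // _ [->|[z Uz ->]]; rewrite lerBlDr.
    by rewrite (le_trans (ge_inf (Dhlb x) (D1 x)))// lerDl.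
  rewrite addrC (le_trans _ (dtri x y z))//.
  by apply: ge_inf => //; right; exists z.
exists (fun x => inf (D x)); split.
- move=> x; apply/cvgrPdist_lt => e e0.
  near=> y; have xy : d x y < e by near: y; exact: near_metric_ball.
  have := lip x y; have := lip y x; rewrite (dC y x) => h1 h2.
  by rewrite ltr_norml; lra.
- by move=> x; rewrite lb_le_inf//= ge_inf.
- move=> x; split=> [Ux|].
    have [e e0 eU] := (dX U).1 oU x Ux.
    apply: (@lt_le_trans _ _ (Num.min e 1)); first by rewrite lt_min e0 ltr01.
    apply: lb_le_inf => // _ [->|[y Uy ->]]; first by rewrite ge_min lexx orbT.
    rewrite ge_min leNgt; case: ltP => //= xy.
    by exfalso; exact: (Uy (eU _ xy)).
  move=> Dx0; apply: contrapT => Ux; move: Dx0.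
  rewrite ltNge => /negP; apply; apply: ge_inf => //.
  by right; exists x => //; rewrite (d0 x x).2.
Unshelve. all: by end_near. Qed.

(** * Locally finite families *)

(** A disguised partition of unity.  Take
    [psi n := max 0 (phi n - n * \sum_(i < n) phi i)].  At [x], the first
    [phi n] that is positive survives unchanged.  If [phi k] is at least
    [delta] near [x], then for [n > k] and [n >= 1 / delta] the subtracted term
    is at least 1, so [psi n] vanishes there. *)
Lemma locally_finite_weights (R : realType) (X : topologicalType)
    (phi : nat -> X -> R) :
  (forall n, continuous (phi n)) -> (forall n x, 0 <= phi n x <= 1) ->
  (forall x, exists n, 0 < phi n x) ->
  exists psi : nat -> X -> R,
    [/\ forall n, continuous (psi n), forall n x, 0 <= psi n x,
        forall n x, 0 < psi n x -> 0 < phi n x,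
        forall x, exists n, 0 < psi n x &
        forall x : X, exists N, \forall y \near x,
          forall n, (N <= n)%N -> psi n y = 0].
Proof.
move=> cphi phi01 phigt0.
pose s n x := \sum_(i < n) phi i x.
have s0 n x : 0 <= s n x.
  by apply: sumr_ge0 => i _; have /andP[] := phi01 i x.
exists (fun n x => Num.max 0 (phi n x - n%:R * s n x)); split.
- move=> n x; apply: (@continuous_max R X (fun=> 0)); first exact: cvg_cst.
  apply: cvgB; first exact: cphi.
  apply: cvgMr; apply: cvg_big => [|i _]; [exact: add_continuous|exact: cphi].
- by move=> n x; rewrite le_max lexx.
- move=> n x; rewrite lt_max ltxx /= subr_gt0.
  by apply: le_lt_trans; exact: mulr_ge0.
- move=> x; case: (ex_minnP (phigt0 x)) => n phin nmin; exists n.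
  rewrite lt_max /s big1 ?mulr0 ?subr0 ?phin ?orbT // => i _.
  apply/eqP; rewrite eq_le; have /andP[-> _] := phi01 i x.
  rewrite andbT leNgt; apply/negP => /nmin.
  by rewrite leqNgt ltn_ord.
- move=> x; have [k phik] := phigt0 x.
  have [m _ Hm] := near_infty_natSinv_lt (PosNum (divr_gt0 phik (ltr0Sn _ 1))).
  exists (maxn k.+1 m.+1).
  have : \forall y \near x, phi k x / 2 < phi k y.
    apply: (cvgr_gt _ (cphi k x)).
    by rewrite ltr_pdivrMr// mulr_natr mulr2n ltrDl.
  apply: filterS => y ylt n; rewrite geq_max => /andP[kn mn].
  apply/max_idPl; rewrite subr_le0.
  have /andP[_ phin1] := phi01 n y; apply: (le_trans phin1) => {phin1}.
  have n0 : 0 < n%:R :> R by rewrite ltr0n (leq_ltn_trans _ kn).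
  have sk : phi k y <= s n y.
    rewrite /s (bigD1 (Ordinal kn)) //= lerDl; apply: sumr_ge0 => i _.
    by have /andP[] := phi01 i y.
  rewrite mulrC -ler_pdivrMr// div1r.
  apply: (le_trans _ sk); apply: (le_trans _ (ltW ylt)); apply: ltW.
  by case: n mn {kn n0 sk} => // n; rewrite ltnS => /Hm.
Qed.

(** The infinite sum is represented by an unspecified function that agrees at
    each point with all sufficiently long partial sums. *)
Lemma locally_finite_sum (R : realType) (V : normedModType R)
    (X : topologicalType) (h : nat -> X -> V) :
  (forall n, continuous (h n)) ->
  (forall x : X, exists N, \forall y \near x,
    forall n, (N <= n)%N -> h n y = 0) ->
  exists2 S : X -> V, continuous S &
    forall x, exists N, forall M, (N <= M)%N -> S x = \sum_(i < M) h i x.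
Proof.
move=> ch lf.
have stab N M y : (forall n, (N <= n)%N -> h n y = 0) -> (N <= M)%N ->
    \sum_(i < M) h i y = \sum_(i < N) h i y.
  move=> hN NM; rewrite -!(big_mkord xpredT (fun i => h i y)).
  rewrite (big_cat_nat (leq0n N) NM)//= [X in _ + X]big1_seq ?addr0// => i.
  by rewrite mem_index_iota => /andP[_ /andP[/hN]].
have pt x : exists N, forall n, (N <= n)%N -> h n x = 0.
  by have [N /nbhs_singleton] := lf x; exists N.
have [Nx NxP] := choice pt.
exists (fun x => \sum_(i < Nx x) h i x); last first.
  by move=> x; exists (Nx x) => M /(stab _ _ _ (NxP x)).
move=> x; have [N nN] := lf x.
apply: (@cvg_trans _ ((fun y => \sum_(i < N) h i y) @ x)).
  apply: near_eq_cvg; near=> y.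
  have hN : forall n, (N <= n)%N -> h n y = 0 by near: y.
  rewrite -(stab _ (maxn N (Nx y)) _ hN) ?leq_maxl//.
  by rewrite -(stab _ (maxn N (Nx y)) _ (NxP y)) ?leq_maxr.
rewrite -(stab _ (maxn N (Nx x)) _ (NxP x)) ?leq_maxr//.
rewrite (stab _ _ _ (nbhs_singleton nN)) ?leq_maxl//.
by apply: cvg_big => [|i _]; [exact: add_continuous|exact: ch].
Unshelve. all: by end_near. Qed.

(** * Convex sets *)

Lemma convex_setP (R : realType) (E : lmodType R) (A : set E) :
  convex_set A <-> forall x y (t : R), 0 <= t -> t <= 1 -> A x -> A y ->
    A (t *: x + (1 - t) *: y).
Proof.
split=> [cA x y t t0 t1 /mem_set Ax /mem_set Ay|
         cA x y l /set_mem Ax /set_mem Ay].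
  by have /set_mem := cA x y (Itv01 t0 t1) Ax Ay.
by apply/mem_set; apply: cA.
Qed.

(** Points of weight zero may lie outside [A]; this is what lets one finite sum
    involve all the [c i] below a bound, including those far from the convex
    set of interest. *)
Lemma convex_combination (R : realType) (E : lmodType R) (A : set E)
    (w : nat -> R) (p : nat -> E) (n : nat) :
  convex_set A -> (forall i, 0 <= w i) -> (forall i, 0 < w i -> A (p i)) ->
  0 < \sum_(i < n) w i ->
  A ((\sum_(i < n) w i)^-1 *: \sum_(i < n) w i *: p i).
Proof.
move=> /convex_setP cA w0 wA.
elim: n => [|n IHn]; first by rewrite big_ord0 ltxx.
rewrite !big_ord_recr /=.
set W := \sum_(i < n) w i in IHn *; set S := \sum_(i < n) w i *: p i in IHn *.
have W0 : 0 <= W by exact: sumr_ge0.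
have [Wz|Wn0] := eqVneq W 0.
  have Sz : S = 0.
    apply: big1 => i _; suff -> : w i = 0 by rewrite scale0r.
    move/eqP : Wz; rewrite psumr_eq0// => /allP/(_ i).
    by rewrite mem_index_enum => /(_ isT)/eqP.
  rewrite Wz Sz !add0r => wn.
  by rewrite scalerA mulVf ?gt_eqF// scale1r; exact: wA.
have {}W0 : 0 < W by rewrite lt_neqAle eq_sym Wn0.
have [->|wn0 _] := eqVneq (w n) 0.
  by rewrite addr0 scale0r addr0 => _; exact: IHn.
have wn : 0 < w n by rewrite lt_neqAle eq_sym wn0 w0.
have Wwn : 0 < W + w n by exact: addr_gt0.
have := cA (W^-1 *: S) (p n) (W / (W + w n)) _ _ (IHn W0) (wA n wn).
rewrite scalerA scalerDr scalerA mulrAC divff ?gt_eqF// mul1r.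
have -> : 1 - W / (W + w n) = (W + w n)^-1 * w n.
  by field; rewrite gt_eqF.
apply; first by rewrite divr_ge0// ltW.
by rewrite ler_pdivrMr// mul1r lerDl ltW.
Qed.
(** * Approximate selections *)

(** Lower continuity tested on balls only, for values that are sets of the
    ambient space. *)
Definition lower_continuous (R : realType) (E : normedModType R)
    (X : topologicalType) (G : X -> set E) : Prop :=
  forall v (r : R), open [set x | exists2 u, G x u & `|v - u| < r].

Definition convex_lower (R : realType) (E : normedModType R)
    (X : topologicalType) (C : set E) (G : X -> set E) : Prop :=
  [/\ forall x, G x `<=` C, forall x, G x !=set0,
      forall x, convex_set (G x) & lower_continuous G].

Definition approx_selection (R : realType) (E : normedModType R)
    (X : topologicalType) (C : set E) (G : X -> set E) (e : R) (g : X -> E) :=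
  [/\ continuous g, forall x, C (g x) &
      forall x, exists2 u, G x u & `|g x - u| < e].

Definition dense_sequence (R : realType) (E : normedModType R) (C : set E)
    (c : nat -> E) : Prop :=
  (forall n, C (c n)) /\
  forall v, C v -> forall e : R, 0 < e -> exists n, `|c n - v| < e.

(** Convexity of the [e]-neighbourhood of [A] relative to [C] is why a convex
    combination of points near [G x] is again near [G x]. *)
Lemma convex_enlargement (R : realType) (E : normedModType R) (C A : set E)
    (e : R) :
  convex_set C -> convex_set A ->
  convex_set [set v | C v /\ exists2 u, A u & `|v - u| < e].
Proof.
move=> /convex_setP cC /convex_setP cA; apply/convex_setP.
move=> x y t t0 t1 [Cx [u Au xu]] [Cy [v Av yv]]; split; first exact: cC.
exists (t *: u + (1 - t) *: v); first exact: cA.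
have -> : t *: x + (1 - t) *: y - (t *: u + (1 - t) *: v) =
    t *: (x - u) + (1 - t) *: (y - v).
  by rewrite !scalerBr opprD addrACA.
have t1' : 0 <= 1 - t by rewrite subr_ge0.
apply: le_lt_trans (ler_normD _ _) _; rewrite !normrZ !ger0_norm//.
have [->|tn0] := eqVneq t 0; first by rewrite mul0r add0r subr0 mul1r.
have tgt0 : 0 < t by rewrite lt_neqAle eq_sym tn0.
apply: (@lt_le_trans _ _ (t * e + (1 - t) * e)).
  by apply: ltr_leD; [rewrite ltr_pM2l|apply: ler_wpM2l => //; exact: ltW].
by rewrite -mulrDl addrC subrK mul1r.
Qed.

Lemma convexI (R : realType) (E : lmodType R) (A B : set E) :
  convex_set A -> convex_set B -> convex_set (A `&` B).
Proof.
move=> /convex_setP cA /convex_setP cB; apply/convex_setP.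
move=> x y t t0 t1 [Ax Bx] [Ay By].
by split; [exact: cA|exact: cB].
Qed.

Lemma convex_norm_ball (R : realType) (E : normedModType R) (v : E) (r : R) :
  convex_set [set u | `|v - u| < r].
Proof.
have c1 : convex_set [set v].
  apply/convex_setP => x y t _ _ /= -> ->.
  by rewrite -scalerDl addrC subrK scale1r.
have cT : convex_set [set: E] by apply/convex_setP.
have /convex_setP H := @convex_enlargement R E _ _ r cT c1.
apply/convex_setP => x y t t0 t1 /= vx vy.
have [||_ [_ -> ]] := H x y t t0 t1 _ _.
- by split => //; exists v; rewrite // distrC.
- by split => //; exists v; rewrite // distrC.
- by rewrite distrC.
Qed.

(** The weights [psi n] live where [c n] is within [e] of [G x], so at each [x]
    only points of the convex [e]-neighbourhood of [G x] are averaged. *)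
Lemma exists_approx_selection (R : realType) (E : normedModType R)
    (X : topologicalType) (C : set E) (c : nat -> E) (G : X -> set E) (e : R) :
  (forall U : set X, open U -> cozero R U) ->
  convex_set C -> dense_sequence C c -> convex_lower C G -> 0 < e ->
  exists g, approx_selection C G e g.
Proof.
move=> cozX convC [Cc densec] [GC G0 convG lowG] e0.
have [phi phiP] := choice (fun n => cozX _ (lowG (c n) e)).
have phigt0 x : exists n, 0 < phi n x.
  have [u Gu] := G0 x; have [n cu] := densec _ (GC _ _ Gu) _ e0.
  by exists n; have [_ _ <-] := phiP n; exists u.
have [| |psi [cpsi psi0 psiphi psigt0 lfpsi]] :=
    locally_finite_weights (phi := phi) _ _ phigt0.
- by move=> n; have [] := phiP n.
- by move=> n; have [] := phiP n.
have [W cW WE] := locally_finite_sum cpsi lfpsi.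
have [||S cS SE] := locally_finite_sum (h := fun n x => psi n x *: c n).
- by move=> n x; apply: cvgZr_tmp; exact: cpsi.
- move=> x; have [N nN] := lfpsi x; exists N.
  by apply: filterS nN => y hN n /hN ->; rewrite scale0r.
have W0 x : 0 < W x.
  have [N WN] := WE x; have [n psin] := psigt0 x.
  rewrite (WN (maxn N n.+1)) ?leq_maxl//.
  have nlt : (n < maxn N n.+1)%N by rewrite leq_maxr.
  by rewrite (bigD1 (Ordinal nlt))//= ltr_pwDl// sumr_ge0.
have K x : C ((W x)^-1 *: S x) /\
    exists2 u, G x u & `|(W x)^-1 *: S x - u| < e.
  have [N WN] := WE x; have [M SM] := SE x.
  have W0x := W0 x; move: W0x.
  rewrite (WN (maxn N M)) ?leq_maxl// (SM (maxn N M)) ?leq_maxr// => W0x.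
  have := @convex_combination R E _ (psi ^~ x) c (maxn N M)
    (@convex_enlargement R E _ _ e convC (convG x)).
  apply => // i /psiphi; have [_ _ <-] := phiP i.
  by move=> [u Gu cu]; split => //; exists u.
exists (fun x => (W x)^-1 *: S x); split=> [x|x|x]; last 2 first.
- by have [] := K x.
- by have [] := K x.
apply: cvgZ; last exact: cS.
by apply: cvgV; [rewrite gt_eqF|exact: cW].
Qed.

(** If [u] in [G x] satisfies the strict inequalities defining both balls, they
    hold with a margin [d]; nearby values [G y] contain a point at distance
    less than [d / 2] of [u], and [g y] is within [d / 2] of [g x]. *)
Lemma lower_continuousI_ball (R : realType) (E : normedModType R)
    (X : topologicalType) (G : X -> set E) (g : X -> E) (r : R) :
  lower_continuous G -> continuous g ->
  lower_continuous (fun x => G x `&` [set u | `|g x - u| < r]).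
Proof.
move=> lowG cg v s; rewrite openE => x [u [Gu /= gu] vu].
pose d := Num.min (r - `|g x - u|) (s - `|v - u|).
have d0 : 0 < d by rewrite lt_min !subr_gt0 gu.
have d20 : 0 < d / 2 by rewrite divr_gt0.
have dr : d <= r - `|g x - u| by rewrite ge_min lexx.
have ds : d <= s - `|v - u| by rewrite ge_min lexx orbT.
have oG : \forall y \near x, exists2 u', G y u' & `|u - u'| < d / 2.
  apply: open_nbhs_nbhs; split; first exact: lowG.
  by exists u; rewrite // subrr normr0.
near=> y.
have [u' Gu' uu'] : exists2 u', G y u' & `|u - u'| < d / 2 by near: y.
have gy : `|g x - g y| < d / 2 by near: y; apply: ((cvgrPdist_lt _ _).1 (cg x)).
exists u'; first split => //=.
  have := ler_distD (g x) (g y) u'; have := ler_distD u (g x) u'.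
  by rewrite (distrC (g y) (g x)); lra.
by have := ler_distD u v u'; lra.
Unshelve. all: by end_near. Qed.

(** The improvement is an approximate selection of [G] cut down to the ball of
    radius [r] around [g]: it is close to [G], and close to [g] as well. *)
Lemma refine_approx_selection (R : realType) (E : normedModType R)
    (X : topologicalType) (C : set E) (c : nat -> E) (G : X -> set E)
    (r e : R) (g : X -> E) :
  (forall U : set X, open U -> cozero R U) ->
  convex_set C -> dense_sequence C c -> convex_lower C G -> 0 < e ->
  approx_selection C G r g ->
  exists2 g', approx_selection C G e g' & forall x, `|g x - g' x| < r + e.
Proof.
move=> cozX convC densec [GC G0 convG lowG] e0 [cg Cg gG].
have [|g' [cg' Cg' g'G]] := @exists_approx_selection R E X C c
  (fun x => G x `&` [set u | `|g x - u| < r]) e cozX convC densec _ e0.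
  split.
  - by move=> x u [/GC].
  - by move=> x; have [u Gu gu] := gG x; exists u.
  - by move=> x; apply: convexI => //; exact: convex_norm_ball.
  - exact: lower_continuousI_ball.
exists g' => [|x]; last first.
  have [u [Gu /= gu] g'u] := g'G x.
  by have := ler_distD u (g x) (g' x); rewrite (distrC u); lra.
by split=> // x; have [u [Gu _] g'u] := g'G x; exists u.
Qed.

(** * Selections of the closure *)

Definition seq_complete (R : realType) (E : normedModType R) (C : set E) :=
  forall u : nat -> E, (forall n, C (u n)) ->
    (forall e : R, 0 < e -> \forall m & n \near \oo, `|u m - u n| < e) ->
    exists2 l, C l & u n @[n --> \oo] --> l.

Lemma geometric_sum_bound (R : realType) (E : normedModType R) (u : nat -> E) :
  (forall k, `|u k - u k.+1| <= 2^-1 ^+ k + 2^-1 ^+ k.+1) ->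
  forall k j, `|u k - u (k + j)%N| <= 4 * 2^-1 ^+ k.
Proof.
move=> ustep k j.
(* The steps are at most [2 * 2 ^- k], so the bound telescopes. *)
suff : `|u k - u (k + j)%N| <= 4 * 2^-1 ^+ k - 4 * 2^-1 ^+ (k + j).
  by have : 0 <= (2^-1 : R) ^+ (k + j) by []; lra.
elim: j => [|j IHj]; first by rewrite addn0 !subrr normr0.
rewrite addnS; have := ler_distD (u (k + j)%N) (u k) (u (k + j).+1).
have := ustep (k + j)%N.
have : 0 <= (2^-1 : R) ^+ (k + j) by [].
by rewrite exprS; lra.
Qed.

Lemma half_pow_small (R : realType) (e : R) : 0 < e ->
  exists k, (4 * 2^-1 ^+ k < e).
Proof.
move=> e0.
have : 4 * (2^-1 : R) ^+ k @[k --> \oo] --> 4 * (0 : R).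
  by apply: cvgMr; apply: cvg_expr; rewrite ger0_norm// invf_lt1// ltr1n.
rewrite mulr0 => /cvgrPdist_lt/(_ e e0)[k _ /(_ k (leqnn k))].
by rewrite sub0r normrN ger0_norm; [exists k|exact: mulr_ge0].
Qed.

(** Michael's selection theorem.  The values of [G] are not assumed closed, and
    the conclusion says that [f x] lies in the closure of [G x]. *)
Lemma michael_selection (R : realType) (E : normedModType R)
    (X : topologicalType) (C : set E) (c : nat -> E) (G : X -> set E) :
  (forall U : set X, open U -> cozero R U) ->
  convex_set C -> seq_complete C -> dense_sequence C c -> convex_lower C G ->
  exists f : X -> E, [/\ continuous f, forall x, C (f x) &
    forall x e, 0 < e -> exists2 u, G x u & `|f x - u| < e].
Proof.
move=> cozX convC complC densec GP.
have step (a : nat * (X -> E)) : exists g',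
    approx_selection C G (2^-1 ^+ a.1) a.2 ->
    approx_selection C G (2^-1 ^+ a.1.+1) g' /\
    forall x, `|a.2 x - g' x| < 2^-1 ^+ a.1 + 2^-1 ^+ a.1.+1.
  have [aG|] := pselect (approx_selection C G (2^-1 ^+ a.1) a.2); last first.
    by move=> na; exists a.2.
  have [|g' g'G g'a] := @refine_approx_selection R E X C c G _
    (2^-1 ^+ a.1.+1) _ cozX convC densec GP _ aG; first exact: exprn_gt0.
  by exists g'.
(* Choosing one improvement for every pair (stage, map) turns the dependent
   choice of the sequence into plain recursion. *)
have [T TP] := choice step.
have [g0 g0G] := exists_approx_selection cozX convC densec GP ltr01.
pose gs := fix gs k := if k is k'.+1 then T (k', gs k') else g0.
have gsG k : approx_selection C G (2^-1 ^+ k) (gs k).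
  by elim: k => [|k IHk]; [rewrite expr0|have [] := TP (k, gs k) IHk].
have gs_step k x : `|gs k x - gs k.+1 x| <= 2^-1 ^+ k + 2^-1 ^+ k.+1.
  by have [_ /(_ x)/ltW] := TP (k, gs k) (gsG k).
have gs_tail k j x : `|gs k x - gs (k + j)%N x| <= 4 * 2^-1 ^+ k.
  by apply: (geometric_sum_bound (u := gs ^~ x)).
have lim x : exists l, C l /\ gs n x @[n --> \oo] --> l.
  have [||l Cl gl] := complC (gs ^~ x); last by exists l.
    by move=> n; have [] := gsG n.
  move=> e e0; have [k ke] := half_pow_small (divr_gt0 e0 (ltr0Sn _ 1)).
  exists ([set n | (k <= n)%N], [set n | (k <= n)%N]).
    by split; exists k.
  move=> [m n] /= [km kn].
  have := gs_tail k (m - k)%N x; have := gs_tail k (n - k)%N x.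
  rewrite !subnKC// => h1 h2.
  have := ler_distD (gs k x) (gs m x) (gs n x).
  by rewrite (distrC (gs m x) (gs k x)); lra.
have [f fP] := choice lim.
have gs_f k x : `|gs k x - f x| <= 4 * 2^-1 ^+ k.
  have [_ gf] := fP x.
  have gf' : `|gs k x - gs n x| @[n --> \oo] --> `|gs k x - f x|.
    by apply: cvg_norm; apply: cvgB => //; exact: cvg_cst.
  apply: (ler_cvg_to gf' (@cvg_cst _ _ _ _ _)); exists k => // n /= kn.
  by rewrite -(subnKC kn).
exists f; split.
- move=> x; apply/cvgrPdist_lt => e e0.
  have [k ke] := half_pow_small (divr_gt0 e0 (ltr0Sn _ 2)).
  have [cg _ _] := gsG k.
  near=> y.
  have gxy : `|gs k x - gs k y| < e / 3.
    by near: y; apply: ((cvgrPdist_lt _ _).1 (cg x)); rewrite divr_gt0.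
  have := gs_f k x; have := gs_f k y; rewrite (distrC (gs k x) (f x)).
  have := ler_distD (gs k x) (f x) (f y).
  by have := ler_distD (gs k y) (gs k x) (f y); lra.
- by move=> x; have [] := fP x.
- move=> x e e0; have [k ke] := half_pow_small (divr_gt0 e0 (ltr0Sn _ 1)).
  have [_ _ /(_ x)[u Gu gu]] := gsG k; exists u => //.
  have := ler_distD (gs k x) (f x) u; have := gs_f k x.
  rewrite (distrC (gs k x) (f x)).
  have : 0 <= (2^-1 : R) ^+ k by [].
  lra.
Unshelve. all: by end_near. Qed.
(** * Dense families of selections *)

Definition guided (R : realType) (E : normedModType R) (X : topologicalType)
    (F : X -> set E) (A : set X) (c : E) (r : R) (x : X) : set E :=
  [set u | F x u /\ (A x -> `|c - u| < r)].

(** Lower continuity: the values of [guided F A c r] meet a ball at [x] when [x]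
    is outside the closed set [A] and [F x] meets the ball, or when [F x] meets
    the ball within the guiding ball, whether or not [x] is in [A].  Both
    conditions are open. *)
Lemma convex_lower_guided (R : realType) (E : normedModType R)
    (X : topologicalType) (C : set E) (F : X -> set E) (A : set X) (c : E)
    (r : R) :
  closed A -> (forall x, A x -> exists2 u, F x u & `|c - u| < r) ->
  convex_lower C F -> convex_lower C (guided F A c r).
Proof.
move=> cA AF [FC F0 convF lowF]; split.
- by move=> x u [/FC].
- move=> x; have [Ax|nAx] := pselect (A x).
    by have [u Fu cu] := AF x Ax; exists u.
  by have [u Fu] := F0 x; exists u.
- move=> x; have [Ax|nAx] := pselect (A x).
    suff -> : guided F A c r x = F x `&` [set u | `|c - u| < r].
      by apply: convexI => //; exact: convex_norm_ball.
    by apply/seteqP; split=> u [Fu cu]; split => //; exact: cu.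
  suff -> : guided F A c r x = F x by [].
  by apply/seteqP; split=> u => [[]|].
- move=> v s.
  have lowFc : lower_continuous (fun x => F x `&` [set u | `|c - u| < r]).
    by apply: (lower_continuousI_ball (g := fun=> c)) => // x; exact: cvg_cst.
  rewrite (_ : [set x | _] =
      (~` A `&` [set x | exists2 u, F x u & `|v - u| < s]) `|`
      [set x | exists2 u, (F x `&` [set u | `|c - u| < r]) u & `|v - u| < s]).
    apply: openU; last exact: lowFc.
    by apply: openI; [exact: closed_openC|exact: lowF].
  apply/seteqP; split=> x /=.
    move=> [u [Fu cu] vu]; have [Ax|nAx] := pselect (A x).
      by right; exists u => //; split => //; exact: cu.
    by left; split => //; exists u.
  by case=> [[nAx [u Fu vu]]|[u [Fu cu] vu]]; exists u.
Qed.

(** In an index [(n, m, k)], [c n] is the target, [1 / (m + 1)] the radius, and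
    [1 / (k + 1)] the level of the closed set [A] on which [phi], the function
    whose positivity set is the set of points where the target is reachable,
    is bounded below. *)
Lemma dense_selections (R : realType) (E : normedModType R)
    (X : topologicalType) (C : set E) (c : nat -> E) (F : X -> set E) :
  (forall U : set X, open U -> cozero R U) ->
  convex_set C -> seq_complete C -> dense_sequence C c -> convex_lower C F ->
  exists f : nat -> X -> E, [/\ forall i, continuous (f i),
    forall i x, C (f i x),
    forall i x e, 0 < e -> exists2 u, F x u & `|f i x - u| < e &
    forall x u e, F x u -> 0 < e -> exists i, `|f i x - u| < e].
Proof.
move=> cozX convC complC densec FP; have [FC _ _ lowF] := FP.
have coz (a : nat * nat) : cozero R
    [set x | exists2 u, F x u & `|c a.1 - u| < a.2.+1%:R^-1].
  exact/cozX/lowF.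
have [phi phiP] := choice coz.
pose A (a : nat * nat * nat) : set X := [set x | a.2.+1%:R^-1 <= phi a.1 x].
have sel (a : nat * nat * nat) : exists f : X -> E,
  [/\ continuous f, forall x, C (f x) &
    forall x e, 0 < e ->
      exists2 u, guided F (A a) (c a.1.1) a.1.2.+1%:R^-1 x u & `|f x - u| < e].
  have [cphi _ phiU] := phiP a.1.
  apply: (michael_selection cozX convC complC densec).
  apply: convex_lower_guided => //.
    have /continuous_closedP/(_ [set r | a.2.+1%:R^-1 <= r]) := cphi.
    by apply; exact: closed_ge.
  by move=> x /= phix; apply/phiU; apply: lt_le_trans phix; rewrite invr_gt0.
have [f fP] := choice sel.
exists (fun i => f (odflt (0, 0, 0)%N (unpickle i))); split.
- by move=> i; have [] := fP (odflt (0, 0, 0)%N (unpickle i)).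
- by move=> i x; have [] := fP (odflt (0, 0, 0)%N (unpickle i)).
- move=> i x e e0; have [_ _ fF] := fP (odflt (0, 0, 0)%N (unpickle i)).
  by have [u [Fu _] fu] := fF x e e0; exists u.
- move=> x u e Fu e0.
  (* The distance from [f x] to [u] is at most the sum of three distances, each
     less than [1 / (m + 1)]: to a point [v] of the guiding ball, from [v] to
     its centre [c n], and from [c n] to [u]. *)
  have [m me] : exists m : nat, m.+1%:R^-1 < e / 3.
    have [m _ Hm] := near_infty_natSinv_lt (PosNum (divr_gt0 e0 (ltr0Sn R 2))).
    by exists m; exact: Hm (leqnn m).
  have m0 : 0 < m.+1%:R^-1 :> R by rewrite invr_gt0.
  have [n cu] := densec.2 u (FC _ _ Fu) _ m0.
  have phix : 0 < phi (n, m) x.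
    by have [_ _ <-] := phiP (n, m); exists u.
  have [k _ /(_ k (leqnn k)) /= ke] := near_infty_natSinv_lt (PosNum phix).
  exists (pickle (n, m, k)); rewrite pickleK /=.
  have [_ _ /(_ x _ m0) [v [_ cv] fv]] := fP (n, m, k).
  have {}cv : `|c n - v| < m.+1%:R^-1 := cv (ltW ke).
  rewrite /= in cu; move: m.+1%:R^-1 me cu fv cv => r rE cu fv cv.
  have := ler_distD v (f (n, m, k) x) u.
  by have := ler_distD (c n) v u; rewrite (distrC v (c n)); lra.
Qed.

(** * The topology induced on [C] *)

Lemma nbhs_set_typeP (R : realType) (E : normedModType R) (C : set E) (v : C)
    (B : set C) :
  nbhs v B <-> exists2 e : R, 0 < e &
    forall u : C, `|set_val v - set_val u| < e -> B u.
Proof.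
split=> [|[e e0 eB]].
  rewrite nbhsE => -[_ [[U oU <-] /= Uv] UB].
  have [e /= e0 eU] := (nbhs_ballP _ _).1 (open_nbhs_nbhs (conj oU Uv)).
  by exists e => // u vu; apply: UB; apply: eU; rewrite -ball_normE.
have vb : nbhs (set_val v) (ball (set_val v) e) by exact: nbhsx_ballx.
have vB : nbhs v (set_val @^-1` ball (set_val v) e).
  exact: (@initial_continuous _ _ (@set_val E C)).
by apply: filterS vB => u; rewrite /= -ball_normE; exact: eB.
Qed.

Lemma closure_set_typeP (R : realType) (E : normedModType R) (C : set E)
    (A : set C) (v : C) :
  closure A v <-> forall e : R, 0 < e ->
    exists2 u, A u & `|set_val v - set_val u| < e.
Proof.
split=> [Av e e0|Av B /nbhs_set_typeP[e e0 eB]].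
  have [|u [Au vu]] := Av [set u | `|set_val v - set_val u| < e].
    by apply/nbhs_set_typeP; exists e.
  by exists u.
by have [u Au vu] := Av e e0; exists u; split => //; exact: eB.
Qed.

Lemma seq_complete_norm_dist (R : realType) (E : normedModType R)
    (C : set E) : metric_complete (@norm_dist R E C) -> seq_complete C.
Proof.
move=> complC u Cu uC.
have [l ul] := complC (fun n => SigSub (mem_set (Cu n))) uC.
exists (set_val l); first exact: set_valP.
apply/cvgrPdist_lt => e e0; have /cvgrPdist_lt/(_ e e0) := ul.
by apply: filterS => n; rewrite sub0r normrN /norm_dist normr_id distrC.
Qed.

(** Non-emptiness of [C] excludes the case of an empty countable dense set, for
    which there is no enumeration. *)
Lemma separable_dense_sequence (R : realType) (E : normedModType R)
    (C : set E) : separable C -> C !=set0 ->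
  exists c, dense_sequence C c.
Proof.
move=> [D cD densD] [v0 Cv0].
have near_D (v : C) e : 0 < e -> exists2 u, D u & `|set_val u - set_val v| < e.
  move=> e0.
  have vB : nbhs v [set u | `|set_val u - set_val v| < e].
    by apply/nbhs_set_typeP; exists e => // u; rewrite distrC.
  move: vB; rewrite nbhsE => -[U [oU Uv] UB].
  have [|u [Uu Du]] := densD U _ oU; first by exists v.
  by exists u => //; exact: UB.
have := cD => /pfcard_geP[D0|[h]].
  have [u] := near_D (SigSub (mem_set Cv0)) 1 ltr01.
  by rewrite D0.
exists (fun n => set_val (h n)); split=> [n|v Cv e e0]; first exact: set_valP.
have [u Du uv] := near_D (SigSub (mem_set Cv)) e e0.
have [n _ hn] := 'surj_h Du.
by exists n; rewrite hn.
Qed.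

Lemma convex_lower_conv_closed (R : realType) (E : normedModType R)
    (X : topologicalType) (C : set E) (F : X -> conv_closed C) :
  continuous F -> convex_lower C (fun x => set_val @` F x).
Proof.
move=> /lower_continuousP lowF; split.
- by move=> x _ [u _ <-]; exact: set_valP.
- by move=> x; have [u Fu] := conv_closed_neq0 (F x); exists (set_val u), u.
- by move=> x; exact: conv_closed_convex.
- move=> v r.
  have oU : open [set u : C | `|v - set_val u| < r].
    rewrite openE => u /= vu; apply/nbhs_set_typeP.
    exists (r - `|v - set_val u|); first by rewrite subr_gt0.
    by move=> w uw /=; have := ler_distD (set_val u) v (set_val w); lra.
  rewrite (_ : [set x | _] =
    [set x | F x `&` [set u : C | `|v - set_val u| < r] !=set0]).
    exact: lowF.
  apply/seteqP; split=> x /=.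
    by move=> [_ [u Fu <-] vu]; exists u.
  by move=> [u [Fu vu]]; exists (set_val u) => //; exists u.
Qed.

(** * The selection theorem *)

Theorem corollary5p5 (R : realType) (E : normedModType R)
    (X : topologicalType) (C : set E) (F : X -> conv_closed C)
    (polish_X : polish R X)
    (convex_C : convex_set C)
    (complete_C : metric_complete (@norm_dist R E C))
    (separable_C : separable (set_type C))
    (lower_F : continuous F) :
  exists f : nat -> X -> C,
    (forall n, continuous (f n)) /\
    (forall x, F x = closure [set f n x | n in [set: nat]] :> set C).
Proof.
(* When [X] is empty so may be [C], and then there is no dense sequence. *)
have [[x0 _]|X0] := pselect ([set: X] !=set0); last first.
  have X0' (x : X) : False by apply: X0; exists x.
  exists (fun _ x => False_rect C (X0' x)).
  by split=> [n x|x]; have := X0' x.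
have [_ [d [dm dX _]]] := polish_X.
have cozX (U : set X) : open U -> cozero R U.
  exact: (cozero_open_metric dm dX).
have [c densec] : exists c, dense_sequence C c.
  apply: separable_dense_sequence separable_C _.
  by have [u _] := conv_closed_neq0 (F x0); exists (set_val u); exact: set_valP.
have [f [cf Cf fF Ff]] := dense_selections cozX convex_C
  (seq_complete_norm_dist complete_C) densec (convex_lower_conv_closed lower_F).
exists (fun n x => SigSub (mem_set (Cf n x))); split=> [n|x].
  apply: (@continuous_comp_initial _ _ _ (@set_val E C)); exact: cf.
apply/seteqP; split=> v.
  move=> Fv; apply/closure_set_typeP => e e0.
  have [|n fv] := Ff x (set_val v) e _ e0; first by exists v.
  exists (SigSub (mem_set (Cf n x))); first by exists n.
  by rewrite distrC.
move=> /closure_set_typeP clv.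
have /closure_id -> : closed (F x) by exact: conv_closed_closed.
apply/closure_set_typeP => e e0.
have e20 : 0 < e / 2 by rewrite divr_gt0.
have [_ [n _ <-] vf] := clv _ e20.
have [_ [u Fu <-] fu] := fF n x _ e20.
exists u => //; have := ler_distD (f n x) (set_val v) (set_val u).
by move: vf => /=; lra.
Qed.
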